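(* Let $E(q)=\prod_{k\ge1}(1-q^k)$, $$X=\frac{E(q^2)^4E(q^3)^8}{E(q)^8E(q^6)^4},\qquad \xi=q^{-2}\frac{E(q^2)^5E(q^9)^4}{E(q)^4E(q^{18})^5},$$ and let $U$ be the operator on formal Laurent series defined by $U\left(\sum_{n\ge n_0}a_nq^n\right)=\sum_{3n\ge n_0}a_{3n}q^n$. Then \begin{align*} U(\xi)&=9X,\\ U(\xi X)&=-9X+252X^2-891X^3+729X^4,\\ U(\xi X^2)&=X-378X^2+8613X^3-54675X^4+138510X^5-150903X^6+59049X^7,\\ U(\xi X^3)&=147X^2-14553X^3+312255X^4-2617839X^5+10764414X^6\\ &\qquad-23914845X^7+29288304X^8-18600435X^9+4782969X^{10}. \end{align*}
   Context: All identities are identities of formal Laurent series in $q$. *)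

(* Defs.v *)
(* Formal power series over rat as coefficient functions
   nat -> rat; formal Laurent series as pairs (v, f) meaning q^v * f. *)
From Stdlib Require Import BinInt.
From mathcomp Require Import all_boot all_order all_algebra.
Set Implicit Arguments. Unset Strict Implicit. Unset Printing Implicit Defensive.
Import Order.TTheory GRing.Theory Num.Theory.
Local Open Scope ring_scope.

Definition fps := nat -> rat.

Definition fps_one : fps := fun n => (n == 0)%:R.

Definition fps_add (f g : fps) : fps := fun n => f n + g n.

Definition fps_scale (c : rat) (f : fps) : fps := fun n => c * f n.

Definition fps_mul (f g : fps) : fps :=
  fun n => \sum_(i < n.+1) f i * g (n - i)%N.

Definition fps_pow (f : fps) (k : nat) : fps := iter k (fps_mul f) fps_one.

(* multiplicative inverse (for f with f 0 <> 0):
   b_0 = 1/a_0,  b_n = -(1/a_0) sum_{i=1}^n a_i b_{n-i};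
   inv_coefs f n = [:: b_0; ...; b_n] *)
Fixpoint inv_coefs (f : fps) (n : nat) : seq rat :=
  match n with
  | 0 => [:: (f 0%N)^-1]
  | m.+1 =>
      let s := inv_coefs f m in
      rcons s (- (f 0%N)^-1 * \sum_(i < m.+1) f i.+1 * nth 0 s (m - i)%N)
  end.

Definition fps_inv (f : fps) : fps := fun n => nth 0 (inv_coefs f n) n.

Definition fps_div (f g : fps) : fps := fps_mul f (fps_inv g).

(* E(q^m) = prod_{k>=1} (1 - q^{m k}); its n-th coefficient equals the n-th
   coefficient of the finite product over 1 <= k <= n (m >= 1). *)
Definition Eq (m : nat) : fps :=
  fun n => (\prod_(1 <= k < n.+1) (1 - 'X^(m * k)) : {poly rat})`_n.

Definition fps_peval (p : {poly rat}) (f : fps) : fps :=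
  fun n => \sum_(i < size p) p`_i * fps_pow f i n.

(* formal Laurent series: (v, f) stands for q^v * f(q) *)
Definition laurent := (int * fps)%type.

Definition lmul (a b : laurent) : laurent := (a.1 + b.1, fps_mul a.2 b.2).

Definition of_fps (f : fps) : laurent := (0, f).

Definition lcoef (a : laurent) (n : int) : rat :=
  match (n - a.1)%R with
  | Posz k => a.2 k
  | Negz _ => 0
  end.

Definition Uop (c : int -> rat) : int -> rat := fun n => c (3 * n).

Definition Xs : fps :=
  fps_div (fps_mul (fps_pow (Eq 2) 4) (fps_pow (Eq 3) 8))
          (fps_mul (fps_pow (Eq 1) 8) (fps_pow (Eq 6) 4)).

Definition xi : laurent :=
  (-2, fps_div (fps_mul (fps_pow (Eq 2) 5) (fps_pow (Eq 9) 4))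
               (fps_mul (fps_pow (Eq 1) 4) (fps_pow (Eq 18) 5))).

Definition UxiX (k : nat) : int -> rat :=
  Uop (lcoef (lmul xi (of_fps (fps_pow Xs k)))).

Definition PX (p : {poly rat}) : int -> rat := lcoef (of_fps (fps_peval p Xs)).

(* rational constant from a binary integer literal (avoids unary nat numerals) *)
Definition zq (z : BinNums.Z) : rat :=
  match z with
  | BinNums.Z0 => 0
  | BinNums.Zpos p => (nat_of_pos p)%:R
  | BinNums.Zneg p => - (nat_of_pos p)%:R
  end.
Arguments zq z%_Z_scope.

(* Main.v *)
(** Write E_m = E(q^m), phi_m = E_m^2 / E_2m, psi_m = E_2m^2 / E_m,
    g = E_1 E_6^3 / (E_2 E_3^3), a = q g(q^3) and c = q g^3, so that a^3 = c(q^3).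
    The Jacobi triple product turns phi_1 and psi_1 into theta series, whose
    3-dissections are phi_1 = phi_9 (1 - 2a) and psi_1 = psi_9 (1 + a) / g(q^3).
    The norm of phi_1 over the series in q^3 gives phi_1^4 = phi_3^4 (1 - 8c).
    Hence X = 1 / (1 - 8c) = (1 - 8a^3) / (1 - 2a)^4 and
    q^2 xi = (1 + a)^2 / (g(q^3)^2 (1 - 2a)), which yields
    q^2 xi X^k = (1 + a)^2 (1 + 2a + 4a^2)^(4k+1) X(q^3)^(3k+1) / g(q^3)^2.
    Keeping the exponents 2 mod 3 of a, U(xi X^k) is X^(3k+1) times an explicit
    polynomial in c, and c = (1 - 1/X) / 8 makes it a polynomial in X. *)
Require Import Defs.
From HB Require Import structures.
From Stdlib Require Import BinInt.
From mathcomp Require Import all_boot all_order all_algebra boolp.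
From mathcomp Require Import ring zify ssrZ.
Import GRing.Theory.
Set Implicit Arguments. Unset Strict Implicit. Unset Printing Implicit Defensive.
Local Open Scope ring_scope.
(* MathComp binds the key %Z to [int_scope]. *)
Delimit Scope Z_scope with BZ.

(** * The ring of formal power series *)

Definition fps_trunc (n : nat) (f : fps) : {poly rat} := \poly_(i < n) f i.

(** Coefficient [n] of a product only involves coefficients up to [n], so truncations compute it.
    The ring laws of [fps] are inherited in this way from those of [{poly rat}]. *)
Lemma coef_fps_mul (f g : fps) (p r : {poly rat}) n :
  (forall i, (i <= n)%N -> p`_i = f i) -> (forall i, (i <= n)%N -> r`_i = g i) ->
  fps_mul f g n = (p * r)`_n.
Proof.
move=> pf rg; rewrite coefM; apply: eq_bigr => i _.
by rewrite pf ?rg ?leq_subr // -ltnS.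
Qed.

Lemma coef_fps_trunc n f i : (i <= n)%N -> (fps_trunc n.+1 f)`_i = f i.
Proof. by move=> le_in; rewrite coef_poly ltnS le_in. Qed.

Lemma fps_mulE f g n :
  fps_mul f g n = (fps_trunc n.+1 f * fps_trunc n.+1 g)`_n.
Proof. by apply: coef_fps_mul => i; apply: coef_fps_trunc. Qed.

Lemma fps_mulC : commutative fps_mul.
Proof. by move=> f g; apply/funext => n; rewrite !fps_mulE mulrC. Qed.

Lemma fps_mulA : associative fps_mul.
Proof.
move=> f g h; apply/funext => n.
rewrite (@coef_fps_mul f _ (fps_trunc n.+1 f) (fps_trunc n.+1 g * fps_trunc n.+1 h)).
- rewrite (@coef_fps_mul _ h (fps_trunc n.+1 f * fps_trunc n.+1 g) (fps_trunc n.+1 h)).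
  + by rewrite mulrA.
  + move=> i le_in; apply/esym/coef_fps_mul => j le_ji;
      exact: coef_fps_trunc (leq_trans le_ji le_in).
  + exact: coef_fps_trunc.
- exact: coef_fps_trunc.
- move=> i le_in; apply/esym/coef_fps_mul => j le_ji;
    exact: coef_fps_trunc (leq_trans le_ji le_in).
Qed.

Lemma fps_mul1 : left_id fps_one fps_mul.
Proof.
move=> f; apply/funext => n; rewrite /fps_mul big_ord_recl /= subn0.
by rewrite /fps_one eqxx mul1r big1 ?addr0 // => i _; rewrite mul0r.
Qed.

Lemma fps_mulDl : left_distributive fps_mul fps_add.
Proof.
move=> f g h; apply/funext => n; rewrite /fps_mul /fps_add -big_split /=.
by apply: eq_bigr => i _; rewrite mulrDl.
Qed.

Lemma fps_addA : associative fps_add.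
Proof. by move=> f g h; apply/funext => n; rewrite /fps_add addrA. Qed.

Lemma fps_addC : commutative fps_add.
Proof. by move=> f g; apply/funext => n; rewrite /fps_add addrC. Qed.

Lemma fps_add0 : left_id (fun=> 0) fps_add.
Proof. by move=> f; apply/funext => n; rewrite /fps_add add0r. Qed.

Lemma fps_addN : left_inverse (fun=> 0) (fun f n => - f n) fps_add.
Proof. by move=> f; apply/funext => n; rewrite /fps_add addNr. Qed.

HB.instance Definition _ := gen_eqMixin fps.
HB.instance Definition _ := gen_choiceMixin fps.
HB.instance Definition _ :=
  GRing.isZmodule.Build fps fps_addA fps_addC fps_add0 fps_addN.

Lemma fps_one_neq0 : fps_one != 0 :> fps.
Proof. by apply/eqP => /(congr1 (fun f : fps => f 0%N)). Qed.

HB.instance Definition _ := GRing.Zmodule_isComNzRing.Build fps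
  fps_mulA fps_mulC fps_mul1 fps_mulDl fps_one_neq0.

(** * Inverses of power series *)

Lemma size_inv_coefs f n : size (inv_coefs f n) = n.+1.
Proof. by elim: n => //= n IHn; rewrite size_rcons IHn. Qed.

Lemma nth_inv_coefs f n i :
  (i <= n)%N -> nth 0 (inv_coefs f n) i = fps_inv f i.
Proof.
elim: n => [|n IHn]; first by rewrite leqn0 => /eqP->.
rewrite leq_eqVlt => /predU1P[-> //|]; rewrite ltnS => le_in.
by rewrite /= nth_rcons size_inv_coefs ltnS le_in IHn.
Qed.

Lemma fps_mulV (f : fps) : f 0%N != 0 -> fps_mul f (fps_inv f) = fps_one.
Proof.
move=> f0; apply/funext => -[|n]; rewrite /fps_mul big_ord_recl /= subn0.
  by rewrite big_ord0 addr0 mulfV.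
rewrite {1}/fps_inv /= nth_rcons size_inv_coefs ltnn eqxx.
rewrite mulrA mulrN mulfV // mulN1r.
apply/eqP; rewrite addrC subr_eq0; apply/eqP/eq_bigr => i _.
by rewrite nth_inv_coefs ?leq_subr //= /bump leq0n add1n subSS.
Qed.

Definition fps_unit : {pred fps} := fun f => f 0%N != 0.
(** The ring structure requires an inverse that is the identity outside the units, hence the default
    value [f]. *)
Definition fps_invr (f : fps) : fps := if f 0%N != 0 then fps_inv f else f.

Lemma fps_mulVr : {in fps_unit, left_inverse 1 fps_invr *%R}.
Proof.
move=> f f0; rewrite mulrC /fps_invr ifT //; exact: fps_mulV.
Qed.

Lemma fps_unitP (f g : fps) : g * f = 1 -> f \in fps_unit.
Proof.
move=> /(congr1 (fun h : fps => h 0%N)); rewrite /= /GRing.mul /=.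
rewrite /fps_mul big_ord1 => gf1; rewrite unfold_in; apply/eqP => f0.
by move: gf1; rewrite f0 mulr0.
Qed.

Lemma fps_invr_out : {in [predC fps_unit], fps_invr =1 id}.
Proof.
by move=> f nf; rewrite /fps_invr ifN.
Qed.

HB.instance Definition _ := GRing.ComNzRing_hasMulInverse.Build fps
  fps_mulVr fps_unitP fps_invr_out.

Lemma fps_unitE (f : fps) : (f \is a GRing.unit) = (f 0%N != 0).
Proof. by []. Qed.

Lemma fps_divE (f g : fps) : g \is a GRing.unit -> fps_div f g = f / g.
Proof. by rewrite fps_unitE => g0; rewrite /GRing.inv /= /fps_invr g0. Qed.

Lemma fps_mul_def (f g : fps) : fps_mul f g = f * g. Proof. by []. Qed.

Lemma fps_powE (f : fps) n : fps_pow f n = f ^+ n.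
Proof. by elim: n => [|n IHn] //; rewrite exprS -IHn. Qed.

Lemma fpsDE (f g : fps) n : (f + g) n = f n + g n. Proof. by []. Qed.
Lemma fpsNE (f : fps) n : (- f) n = - f n. Proof. by []. Qed.

Lemma fps0E n : (0 : fps) n = 0. Proof. by []. Qed.

Lemma fps1E n : (1 : fps) n = (n == 0%N)%:R. Proof. by []. Qed.

Lemma fpsME (f g : fps) n : (f * g) n = \sum_(i < n.+1) f i * g (n - i)%N.
Proof. by []. Qed.

Lemma fpsBE (f g : fps) n : (f - g) n = f n - g n. Proof. by []. Qed.

Lemma fps_sumE I (r : seq I) (P : pred I) (F : I -> fps) n :
  (\sum_(i <- r | P i) F i) n = \sum_(i <- r | P i) F i n.
Proof. by apply: (big_morph (fun f : fps => f n)). Qed.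

(** * Polynomials as power series, and the variable q *)

Definition fps_of_poly (p : {poly rat}) : fps := fun n => p`_n.

Lemma fps_of_polyB : zmod_morphism fps_of_poly.
Proof. by move=> p r; apply/funext => n; rewrite /fps_of_poly coefB. Qed.

Lemma fps_of_polyM : monoid_morphism fps_of_poly.
Proof.
split=> [|p r]; apply/funext => n; first by rewrite /fps_of_poly coef1.
by rewrite /fps_of_poly coefM.
Qed.

HB.instance Definition _ :=
  GRing.isZmodMorphism.Build {poly rat} fps fps_of_poly fps_of_polyB.
HB.instance Definition _ :=
  GRing.isMonoidMorphism.Build {poly rat} fps fps_of_poly fps_of_polyM.

Definition q : fps := fps_of_poly 'X.

Lemma fps_of_polyXn k : fps_of_poly 'X^k = q ^+ k.
Proof. by rewrite rmorphXn. Qed.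

Lemma qXE k n : (q ^+ k) n = (n == k)%:R.
Proof. by rewrite -fps_of_polyXn /fps_of_poly coefXn. Qed.

Lemma coef_qXM k (f : fps) n :
  (q ^+ k * f) n = if (n < k)%N then 0 else f (n - k)%N.
Proof.
rewrite fpsME; case: ltnP => [lt_nk|le_kn].
  rewrite big1 // => i _; rewrite qXE (_ : _ == _ = false) ?mul0r //.
  by apply/eqP => eq_ik; move: (ltn_ord i); rewrite eq_ik ltnS leqNgt lt_nk.
rewrite (bigD1 (inord k)) //= qXE inordK ?ltnS // eqxx mul1r big1 ?addr0 //.
move=> i ne_ik; rewrite qXE (_ : _ == _ = false) ?mul0r //.
by apply: contraNF ne_ik => /eqP eq_ik; rewrite -val_eqE /= inordK ?ltnS // eq_ik.
Qed.

(** * Trisection *)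

(** The substitution of q^3 for q, written f(q^3) below. *)
Definition dil3 (f : fps) : fps := fun n => if (3 %| n)%N then f (n %/ 3)%N else 0.

Lemma dil3B : zmod_morphism dil3.
Proof.
move=> f g; apply/funext => n; rewrite fpsBE /dil3.
by case: ifP; rewrite ?subr0.
Qed.

Lemma dil3M : monoid_morphism dil3.
Proof.
split=> [|f g]; apply/funext => n.
  rewrite /dil3 !fps1E; case: ifP => [/dvdnP[k ->]|]; first by rewrite mulnK // muln_eq0 orbF.
  by case: n.
(* On truncations the substitution is composition with ['X^3], which is a ring morphism of
   polynomials. *)
have dil3E (h : fps) i : (i <= n)%N -> (fps_trunc n.+1 h \Po 'X^3)`_i = dil3 h i.
  move=> le_in; rewrite coef_comp_poly_Xn // /dil3; case: ifP => // _.
  by rewrite coef_fps_trunc // (leq_trans (leq_div _ _)).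
rewrite [RHS](coef_fps_mul (dil3E f) (dil3E g)) -rmorphM /=.
rewrite coef_comp_poly_Xn // /dil3; case: ifP => // _.
by apply: coef_fps_mul => i le_in; rewrite coef_fps_trunc // (leq_trans le_in) ?leq_div.
Qed.

HB.instance Definition _ := GRing.isZmodMorphism.Build fps fps dil3 dil3B.
HB.instance Definition _ := GRing.isMonoidMorphism.Build fps fps dil3 dil3M.

Lemma dil3_q : dil3 q = q ^+ 3.
Proof.
apply/funext => n; rewrite qXE /dil3 -[q]expr1 qXE.
case: ifP => [/dvdnP[k ->]|]; first by rewrite mulnK //; congr (nat_of_bool _)%:R; lia.
by move=> h; case: eqP => // E; move: h; rewrite E.
Qed.

(** Because of the factor q^(-2) in [xi], the operator U acts on [xi] times a power series as
    [sect3 2] acts on the power series part. *)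
Definition sect3 (i : nat) (f : fps) : fps := fun n => f (3 * n + i)%N.

Lemma sect3_join (f g h : fps) :
  let F := dil3 f + q * dil3 g + q ^+ 2 * dil3 h in
  [/\ sect3 0 F = f, sect3 1 F = g & sect3 2 F = h].
Proof.
split; apply/funext => n; rewrite /sect3 !fpsDE -[q as X in X * _]expr1 !coef_qXM /dil3.
- rewrite addn0 dvdn_mulr // mulKn //.
  case: n => [|n]; first by rewrite !addr0.
  repeat (rewrite ifF; last by lia).
  by rewrite !addr0.
- rewrite (_ : (3 %| _)%N = false) ?add0r; last by lia.
  rewrite addnK dvdn_mulr // mulKn // ifF; last by lia.
  case: n => [|n]; first by rewrite addr0.
  repeat (rewrite ifF; last by lia).
  by rewrite addr0.
- rewrite (_ : (3 %| _)%N = false) ?add0r; last by lia.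
  rewrite ifF; last by lia.
  rewrite (_ : (3 %| _)%N = false) ?add0r; last by lia.
  by rewrite ifF ?addnK ?dvdn_mulr ?mulKn //; lia.
Qed.

Lemma sect3E (f : fps) :
  f = dil3 (sect3 0 f) + q * dil3 (sect3 1 f) + q ^+ 2 * dil3 (sect3 2 f).
Proof.
have [F0 F1 F2] := sect3_join (sect3 0 f) (sect3 1 f) (sect3 2 f).
set F := (X in f = X) in F0 F1 F2 *; apply/funext => n.
have -> : n = (3 * (n %/ 3) + n %% 3)%N by rewrite mulnC -divn_eq.
have: (n %% 3 < 3)%N by rewrite ltn_mod.
have sectE (i : nat) : sect3 i F = sect3 i f ->
   f (3 * (n %/ 3) + i)%N = F (3 * (n %/ 3) + i)%N.
  by move/(congr1 (fun h : fps => h (n %/ 3)%N)).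
by case: (n %% 3)%N => [|[|[|]]] // _; apply: sectE.
Qed.

(** Multiply the two decompositions and reduce powers of q by q^3 = [dil3 q]; the components are
    unique by [sect3_join]. *)
Lemma sect3M (f g : fps) :
  [/\ sect3 0 (f * g) = sect3 0 f * sect3 0 g
        + q * (sect3 1 f * sect3 2 g + sect3 2 f * sect3 1 g),
      sect3 1 (f * g) = sect3 0 f * sect3 1 g + sect3 1 f * sect3 0 g
        + q * (sect3 2 f * sect3 2 g)
    & sect3 2 (f * g) = sect3 0 f * sect3 2 g + sect3 1 f * sect3 1 g
        + sect3 2 f * sect3 0 g].
Proof.
rewrite (_ : f * g = dil3 (sect3 0 f * sect3 0 g
     + q * (sect3 1 f * sect3 2 g + sect3 2 f * sect3 1 g))
   + q * dil3 (sect3 0 f * sect3 1 g + sect3 1 f * sect3 0 g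
     + q * (sect3 2 f * sect3 2 g))
   + q ^+ 2 * dil3 (sect3 0 f * sect3 2 g + sect3 1 f * sect3 1 g
     + sect3 2 f * sect3 0 g)); last first.
  rewrite {1}[f]sect3E {1}[g]sect3E.
  by rewrite !(rmorphD, rmorphM) /= dil3_q; ring.
exact: sect3_join.
Qed.

(** With t^3 = q, this is the norm of f(t) = u + v t + w t^2 over the series in q, that is, the
    product of f(t), f(wt), f(w^2 t) for w a primitive cube root of unity. The explicit form avoids
    adjoining roots of unity. *)
Definition norm3 (f : fps) : fps :=
  sect3 0 f ^+ 3 + q * sect3 1 f ^+ 3 + q ^+ 2 * sect3 2 f ^+ 3
  - 3 * q * (sect3 0 f * sect3 1 f * sect3 2 f).

Lemma norm3M : {morph norm3 : f g / f * g}.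
Proof.
by move=> f g; rewrite /norm3; have [-> -> ->] := sect3M f g; ring.
Qed.

Lemma norm3_join (f g : fps) : norm3 (dil3 f + q * dil3 g) = f ^+ 3 + q * g ^+ 3.
Proof.
have [] := sect3_join f g 0; rewrite rmorph0 mulr0 addr0 /norm3 => -> -> ->; ring.
Qed.

Lemma norm3_1BqX3 k : norm3 (1 - q ^+ (3 * k)) = (1 - q ^+ k) ^+ 3.
Proof.
rewrite (_ : 1 - _ = dil3 (1 - q ^+ k) + q * dil3 0) ?norm3_join; first by ring.
by rewrite rmorphB rmorphXn /= dil3_q rmorph1 rmorph0 mulr0 addr0 exprM.
Qed.

(** The three conjugates of 1 - t^k multiply to 1 - t^(3k), and t^3 = q. Here the two nonzero
    residues of [k] mod 3 are treated separately. *)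
Lemma norm3_1BqX k : ~~ (3 %| k)%N -> norm3 (1 - q ^+ k) = 1 - q ^+ k.
Proof.
rewrite (divn_eq k 3) dvdn_addr ?dvdn_mull //; have: (k %% 3 < 3)%N by rewrite ltn_mod.
move: (k %/ 3)%N => j; case: (k %% 3)%N => [|[|[|]]] // _ _.
- rewrite {1}(_ : 1 - _ = dil3 1 + q * dil3 (- q ^+ j)) ?norm3_join.
    by rewrite exprD exprM; ring.
  by rewrite rmorphN rmorphXn /= dil3_q rmorph1 exprD mulnC exprM; ring.
- have [] := sect3_join 1 0 (- q ^+ j).
  rewrite rmorph0 mulr0 addr0 rmorphN rmorphXn /= dil3_q rmorph1.
  rewrite (_ : 1 + _ = 1 - q ^+ (j * 3 + 2)); last by rewrite exprD mulnC exprM; ring.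
  by rewrite /norm3 => -> -> ->; rewrite exprD exprM; ring.
Qed.

(** * Congruence modulo powers of q *)

Definition eqmodq n (f g : fps) := forall i, (i < n)%N -> f i = g i.

Lemma eqmodqD n f g f' g' :
  eqmodq n f g -> eqmodq n f' g' -> eqmodq n (f + f') (g + g').
Proof. by move=> fg fg' i lt_in; rewrite !fpsDE fg ?fg'. Qed.

Lemma eqmodqN n f g : eqmodq n f g -> eqmodq n (- f) (- g).
Proof. by move=> fg i lt_in; rewrite !fpsNE fg. Qed.

Lemma eqmodqM n f g f' g' :
  eqmodq n f g -> eqmodq n f' g' -> eqmodq n (f * f') (g * g').
Proof.
move=> fg fg' i lt_in; rewrite !fpsME; apply: eq_bigr => j _.
rewrite fg ?fg' //; last by apply: leq_ltn_trans lt_in; rewrite -ltnS.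
by apply: leq_ltn_trans lt_in; apply: leq_subr.
Qed.

Lemma eqmodq_trans n f g h : eqmodq n f g -> eqmodq n g h -> eqmodq n f h.
Proof. by move=> fg gh i lt_in; rewrite fg ?gh. Qed.

Lemma eqmodq_sym n f g : eqmodq n f g -> eqmodq n g f.
Proof. by move=> fg i lt_in; rewrite fg. Qed.

Lemma eqmodq_le m n f g : (m <= n)%N -> eqmodq n f g -> eqmodq m f g.
Proof. by move=> le_mn fg i lt_im; apply: fg; apply: leq_trans le_mn. Qed.

Lemma eqmodqV n (f g : fps) : f \is a GRing.unit -> g \is a GRing.unit ->
  eqmodq n f g -> eqmodq n f^-1 g^-1.
Proof.
move=> Uf Ug fg.
(* The two sides simplify to the inverses of f and of g. *)
have: eqmodq n (f^-1 * g^-1 * g) (f^-1 * g^-1 * f).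
  by apply: eqmodqM => //; apply: eqmodq_sym.
by rewrite divrK // [X in eqmodq _ _ X]mulrC mulVKr.
Qed.

Lemma eqmodq_qXM n k (f : fps) : (n <= k)%N -> eqmodq n (q ^+ k * f) 0.
Proof. by move=> le_nk i lt_in; rewrite coef_qXM (leq_trans lt_in). Qed.

(** * Convergence *)

(** Convergence in the q-adic topology. Infinite products and theta series are handled as limits of
    finite ones, so that every identity is first proved exactly at a finite level. *)
Definition fps_cvg (u : nat -> fps) (f : fps) :=
  forall n, exists M, forall N, (M <= N)%N -> eqmodq n (u N) f.

Lemma fps_cvg_uniq u f g : fps_cvg u f -> fps_cvg u g -> f = g.
Proof.
move=> uf ug; apply/funext => n; have [M1 H1] := uf n.+1; have [M2 H2] := ug n.+1.
by rewrite -(H1 (maxn M1 M2)) ?leq_maxl // -(H2 (maxn M1 M2)) ?leq_maxr.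
Qed.

Lemma fps_cvg_cst f : fps_cvg (fun=> f) f.
Proof. by move=> n; exists 0%N. Qed.

Lemma eq_fps_cvg u v f : u =1 v -> fps_cvg u f -> fps_cvg v f.
Proof. by move=> uv uf n; have [M H] := uf n; exists M => N; rewrite -uv; apply: H. Qed.

Lemma fps_cvgD u v f g :
  fps_cvg u f -> fps_cvg v g -> fps_cvg (fun n => u n + v n) (f + g).
Proof.
move=> uf ug n; have [M1 H1] := uf n; have [M2 H2] := ug n; exists (maxn M1 M2) => N.
by rewrite geq_max => /andP[? ?]; apply: eqmodqD; [apply: H1 | apply: H2].
Qed.

Lemma fps_cvgN u f : fps_cvg u f -> fps_cvg (fun n => - u n) (- f).
Proof. by move=> uf n; have [M H] := uf n; exists M => N /H; apply: eqmodqN. Qed.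

Lemma fps_cvgM u v f g :
  fps_cvg u f -> fps_cvg v g -> fps_cvg (fun n => u n * v n) (f * g).
Proof.
move=> uf ug n; have [M1 H1] := uf n; have [M2 H2] := ug n; exists (maxn M1 M2) => N.
by rewrite geq_max => /andP[? ?]; apply: eqmodqM; [apply: H1 | apply: H2].
Qed.

Lemma fps_cvgX u f k : fps_cvg u f -> fps_cvg (fun n => u n ^+ k) (f ^+ k).
Proof.
move=> uf; elim: k => [|k IHk]; first exact: fps_cvg_cst.
rewrite exprS; apply: eq_fps_cvg (fps_cvgM uf IHk) => n; by rewrite exprS.
Qed.

Lemma fps_cvgV u f : (forall n, u n \is a GRing.unit) -> f \is a GRing.unit ->
  fps_cvg u f -> fps_cvg (fun n => (u n)^-1) f^-1.
Proof.
by move=> Uu Uf uf n; have [M H] := uf n; exists M => N /H; apply: eqmodqV.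
Qed.

Lemma fps_cvg_sub u f (s : nat -> nat) :
  (forall n, (n <= s n)%N) -> fps_cvg u f -> fps_cvg (fun n => u (s n)) f.
Proof.
by move=> les uf n; have [M H] := uf n; exists M => N /leq_trans/(_ (les N)); apply: H.
Qed.

Lemma fps_cvg_dil3 u f : fps_cvg u f -> fps_cvg (fun n => dil3 (u n)) (dil3 f).
Proof.
move=> uf n; have [M H] := uf n; exists M => N /H uNf i lt_in.
by rewrite /dil3; case: ifP => // _; apply: uNf; apply: leq_ltn_trans (leq_div _ _) lt_in.
Qed.

Lemma fps_cvg_sect3 u f i :
  fps_cvg u f -> fps_cvg (fun n => sect3 i (u n)) (sect3 i f).
Proof.
move=> uf n; have [M H] := uf (3 * n + i)%N; exists M => N /H uNf j lt_jn.
by apply: uNf; rewrite ltn_add2r ltn_mul2l.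
Qed.

Lemma fps_cvg_norm3 u f : fps_cvg u f -> fps_cvg (fun n => norm3 (u n)) (norm3 f).
Proof.
move=> uf; rewrite /norm3.
have cvgS i := fps_cvg_sect3 i uf.
apply: fps_cvgD; last first.
  apply/fps_cvgN/fps_cvgM; first exact: fps_cvg_cst.
  by apply: fps_cvgM => //; apply: fps_cvgM.
apply: fps_cvgD; last by apply: fps_cvgM; [apply: fps_cvg_cst | apply: fps_cvgX].
apply: fps_cvgD; first exact: fps_cvgX.
by apply: fps_cvgM; [apply: fps_cvg_cst | apply: fps_cvgX].
Qed.

(** * Finite Euler products and their norms *)

Definition Eprod m N : fps := \prod_(k < N) (1 - q ^+ (m * k.+1)).

Lemma EprodS m N : Eprod m N.+1 = Eprod m N * (1 - q ^+ (m * N.+1)).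
Proof. by rewrite /Eprod big_ord_recr. Qed.

(** Each factor beyond the first [n] is 1 modulo q^(n+1). *)
Lemma Eprod_stable m N n : (0 < m)%N -> (n <= N)%N -> eqmodq n.+1 (Eprod m N) (Eprod m n).
Proof.
move=> m_gt0; elim: N => [|N IHN]; first by rewrite leqn0 => /eqP->.
rewrite leq_eqVlt => /predU1P[->//|]; rewrite ltnS => le_nN.
rewrite EprodS mulrBr mulr1 -[X in eqmodq _ _ X]addr0; apply: eqmodqD; first exact: IHN.
rewrite mulrC -mulrN; apply: eqmodq_qXM; nia.
Qed.

Lemma Eq_Eprod m n : Eq m n = Eprod m n n.
Proof.
rewrite /Eq -/(fps_of_poly _ n) rmorph_prod /= big_add1 /= big_mkord.
congr (_ n); apply: eq_bigr => i _.
by rewrite rmorphB rmorph1 /= fps_of_polyXn.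
Qed.

Lemma eqmodq_Eprod m N : (0 < m)%N -> eqmodq N.+1 (Eprod m N) (Eq m).
Proof.
by move=> m_gt0 i; rewrite ltnS => le_iN; rewrite Eq_Eprod (Eprod_stable m_gt0 le_iN).
Qed.

Lemma cvg_Eprod m : (0 < m)%N -> fps_cvg (Eprod m) (Eq m).
Proof.
move=> m_gt0 n; exists n => N le_nN.
by apply: (@eqmodq_le _ N.+1); [apply: leqW | apply: eqmodq_Eprod].
Qed.

Lemma Eprod_unit m N : (0 < m)%N -> Eprod m N \is a GRing.unit.
Proof.
move=> m_gt0; rewrite fps_unitE (Eprod_stable m_gt0 (leq0n N)) //.
by rewrite /Eprod big_ord0 fps1E oner_eq0.
Qed.

Lemma Eq_unit m : (0 < m)%N -> Eq m \is a GRing.unit.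
Proof. by move=> m_gt0; rewrite fps_unitE Eq_Eprod /Eprod big_ord0 fps1E oner_eq0. Qed.

Lemma dil3_Eq m : (0 < m)%N -> dil3 (Eq m) = Eq (3 * m).
Proof.
move=> m_gt0; apply: (fps_cvg_uniq (fps_cvg_dil3 (cvg_Eprod m_gt0))).
have m3_gt0 : (0 < 3 * m)%N by rewrite muln_gt0.
apply: eq_fps_cvg (cvg_Eprod m3_gt0) => N.
rewrite /Eprod rmorph_prod; apply: eq_bigr => k _.
by rewrite rmorphB rmorph1 rmorphXn /= dil3_q -exprM mulnA.
Qed.

Lemma norm3_1 : norm3 1 = 1.
Proof.
have := norm3_join 1 0; rewrite rmorph1 rmorph0 mulr0 addr0 => ->.
by rewrite expr1n expr0n mulr0 addr0.
Qed.

(** The norm fixes the factors of index prime to 3 and turns the factor of index 3j into (1 -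
    q^(mj))^3. Multiplying by [Eprod (3 * m) N] restores the factors of index 3j. *)
Lemma norm3_Eprod m N : ~~ (3 %| m)%N ->
  norm3 (Eprod m (3 * N)) * Eprod (3 * m) N = Eprod m (3 * N) * Eprod m N ^+ 3.
Proof.
move=> n3m; elim: N => [|N IHN].
  by rewrite muln0 /Eprod !big_ord0 expr1n norm3_1.
rewrite (_ : 3 * N.+1 = (3 * N).+3)%N; last by lia.
rewrite !EprodS !norm3M [norm3 (1 - q ^+ (m * (3 * N).+1))]norm3_1BqX; last first.
  by rewrite Euclid_dvdM // negb_or n3m; lia.
rewrite [norm3 (1 - q ^+ (m * (3 * N).+2))]norm3_1BqX; last first.
  by rewrite Euclid_dvdM // negb_or n3m; lia.
rewrite (_ : m * (3 * N).+3 = 3 * (m * N.+1))%N; last by lia.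
rewrite norm3_1BqX3 -mulnA.
rewrite [LHS](_ : _ = norm3 (Eprod m (3 * N)) * Eprod (3 * m) N *
  ((1 - q ^+ (m * (3 * N).+1)) * (1 - q ^+ (m * (3 * N).+2)) *
   (1 - q ^+ (m * N.+1)) ^+ 3 * (1 - q ^+ (3 * (m * N.+1))))); last by ring.
by rewrite IHN; ring.
Qed.

Lemma norm3_Eq m : (0 < m)%N -> ~~ (3 %| m)%N -> norm3 (Eq m) * Eq (3 * m) = Eq m ^+ 4.
Proof.
move=> m_gt0 n3m; have m3_gt0 : (0 < 3 * m)%N by rewrite muln_gt0.
have le3 n : (n <= 3 * n)%N by lia.
have cvg3 := fps_cvg_sub le3 (cvg_Eprod m_gt0).
apply: (fps_cvg_uniq (fps_cvgM (fps_cvg_norm3 cvg3) (cvg_Eprod m3_gt0))).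
rewrite exprS; apply: eq_fps_cvg (fps_cvgM cvg3 (fps_cvgX 3 (cvg_Eprod m_gt0))) => N.
by rewrite /= norm3_Eprod.
Qed.

(** * The Jacobi triple product *)

(** The Gaussian binomial coefficient (i+j choose i) in base q^m. *)
Definition qbinom m i j : fps := Eprod m (i + j) / (Eprod m i * Eprod m j).

Lemma qbinom0n m n : (0 < m)%N -> qbinom m 0 n = 1.
Proof.
move=> m_gt0; rewrite /qbinom add0n {2}/Eprod big_ord0 mul1r divrr //.
exact: Eprod_unit.
Qed.

Lemma qbinomC m i j : qbinom m i j = qbinom m j i.
Proof. by rewrite /qbinom addnC [Eprod m i * _]mulrC. Qed.

(** The q-Pascal rule. With x = q^(m(i+1)) and y = q^(m(j+1)), all three coefficients are multiples
    of a common factor [C], and the rule becomes 1 - xy = (1 - y) + y(1 - x). *)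
Lemma qbinomSS m i j : (0 < m)%N ->
  qbinom m i.+1 j.+1 = qbinom m i.+1 j + q ^+ (m * j.+1) * qbinom m i j.+1.
Proof.
move=> m_gt0; have UE k := Eprod_unit k m_gt0.
have UD k : 1 - q ^+ (m * k.+1) \is a GRing.unit.
  by have := UE k.+1; rewrite EprodS unitrM => /andP[].
have UEE k l : Eprod m k * Eprod m l \is a GRing.unit by rewrite unitrM !UE.
set C := Eprod m (i + j).+1 / (Eprod m i.+1 * Eprod m j.+1).
rewrite (_ : qbinom m i.+1 j.+1 = C * (1 - q ^+ (m * i.+1) * q ^+ (m * j.+1))).
  rewrite (_ : qbinom m i.+1 j = C * (1 - q ^+ (m * j.+1))).
    rewrite (_ : qbinom m i j.+1 = C * (1 - q ^+ (m * i.+1))); first by ring.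
    apply: (mulIr (UEE i.+1 j.+1)); rewrite [RHS]mulrAC /C divrK // [Eprod m i.+1]EprodS.
    by rewrite [_ * Eprod m j.+1]mulrAC mulrA /qbinom addnS divrK.
  apply: (mulIr (UEE i.+1 j.+1)); rewrite [RHS]mulrAC /C divrK // [Eprod m j.+1]EprodS.
  by rewrite !mulrA -[_ * Eprod m i.+1 * _]mulrA /qbinom addSn divrK.
by rewrite /C /qbinom addSn addnS EprodS mulrAC -exprD -mulnDr addSn addnS.
Qed.

Lemma qbinom_sumS m n (x : nat -> fps) : (0 < m)%N ->
  \sum_(j < n.+2) qbinom m j (n.+1 - j) * x j =
  \sum_(j < n.+1) qbinom m j (n - j) * x j
  + \sum_(j < n.+1) qbinom m j (n - j) * (q ^+ (m * (n - j)) * x j.+1).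
Proof.
move=> m_gt0; rewrite big_ord_recl big_ord_recr /= [in RHS]big_ord_recl.
rewrite [X in _ = _ + X]big_ord_recr /= !subn0 !subnn muln0 expr0 mul1r.
rewrite !qbinom0n // -!addrA; congr (_ + _); rewrite addrA; congr (_ + _); last first.
  by rewrite /bump add1n !(qbinomC _ _ 0) !qbinom0n.
rewrite -big_split; apply: eq_bigr => i _ /=; rewrite /bump !add1n subSS.
case: i => i /= lt_in; have -> : (n - i = (n - i.+1).+1)%N by lia.
by rewrite qbinomSS //; ring.
Qed.

Section JacobiTripleProduct.
Variables (m : nat) (a b : fps).
Hypotheses (m_gt0 : (0 < m)%N) (abE : a * b = q ^+ m).

(** The term q^(m n(n-1)/2) a^n of the bilateral theta series, for n = j - N. Since ab = q^m, for n
    = -p < 0 it equals q^(m p(p-1)/2) b^p, which needs no inverse of a. *)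
Definition theta_term N j : fps :=
  if (N <= j)%N then q ^+ (m * 'C(j - N, 2)) * a ^+ (j - N)
  else q ^+ (m * 'C(N - j, 2)) * b ^+ (N - j).

Lemma theta_termS M N j : (j <= M + N)%N ->
  theta_term N j * (a * q ^+ (m * M)) = q ^+ (m * (M + N - j)) * theta_term N j.+1.
Proof.
rewrite /theta_term => le_jMN; case: (leqP N j) => [le_Nj|lt_jN].
  rewrite ifT ?leqW // subSn // binS bin1 exprS mulnDr [q ^+ (_ + _)]exprD.
  rewrite (_ : m * M = m * (M + N - j) + m * (j - N))%N; first by rewrite exprD; ring.
  by rewrite -mulnDr; congr (_ * _)%N; lia.
have -> : (N - j = (N - j.+1).+1)%N by lia.
rewrite binS bin1 exprS mulnDr [q ^+ (_ + _)]exprD.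
rewrite [LHS](_ : _ = (a * b) * q ^+ (m * (N - j.+1)) * q ^+ (m * M) *
  (q ^+ (m * 'C(N - j.+1, 2)) * b ^+ (N - j.+1))); last by ring.
rewrite abE -!exprD; congr (q ^+ _ * _); first by nia.
(* At the boundary N = j + 1 the two branches of [theta_term] agree, both being 1. *)
by case: (leqP N j.+1) => // le_Nj; rewrite (_ : N = j.+1) ?subnn //; lia.
Qed.

(** Induction on the number of factors in a: [qbinom_sumS] splits the larger sum, and [theta_termS]
    matches its second half with the new factor's contribution. *)
Lemma jacobi_step N :
  \prod_(k < N) (1 + b * q ^+ (m * k)) =
    \sum_(j < N.+1) qbinom m j (N - j) * theta_term N j ->
  forall M, \prod_(k < M) (1 + a * q ^+ (m * k)) * \prod_(k < N) (1 + b * q ^+ (m * k))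
    = \sum_(j < (M + N).+1) qbinom m j (M + N - j) * theta_term N j.
Proof.
move=> baseN; elim=> [|M IHM]; first by rewrite big_ord0 mul1r.
rewrite big_ord_recr /= mulrAC IHM mulrDr mulr1 addSn qbinom_sumS //; congr (_ + _).
rewrite big_distrl /=; apply: eq_bigr => j _.
by rewrite -mulrA theta_termS // -ltnS.
Qed.
End JacobiTripleProduct.

Lemma jacobi_finite m (a b : fps) M N : (0 < m)%N -> a * b = q ^+ m ->
  \prod_(k < M) (1 + a * q ^+ (m * k)) * \prod_(k < N) (1 + b * q ^+ (m * k))
    = \sum_(j < (M + N).+1) qbinom m j (M + N - j) * theta_term m a b N j.
Proof.
move=> m_gt0 abE; apply: jacobi_step => //.
have baE : b * a = q ^+ m by rewrite mulrC.
have base0 : \prod_(k < 0) (1 + a * q ^+ (m * k)) =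
    \sum_(j < 1) qbinom m j (0 - j) * theta_term m b a 0 j.
  by rewrite big_ord1 big_ord0 qbinom0n // /theta_term /= mul1r muln0 !expr0 mulr1.
(* The start, a product in b alone, is the same step with a and b exchanged, followed by reversal of
   the sum. *)
have := jacobi_step m_gt0 baE base0 N; rewrite big_ord0 mulr1 addn0 => ->.
rewrite (reindex_inj rev_ord_inj) /=; apply: eq_bigr => -[j lt_jN] _ /=.
rewrite subSS subKn // qbinomC /theta_term /= subn0; case: leqP => // le_Nj.
by rewrite (_ : j = N) ?subnn //; lia.
Qed.

Definition theta m (a b : fps) N : fps :=
  1 + \sum_(k < N) q ^+ (m * 'C(k.+1, 2)) * (a ^+ k.+1 + b ^+ k.+1).

Lemma thetaE m a b N : theta m a b N = \sum_(j < (N + N).+1) theta_term m a b N j.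
Proof.
rewrite -addnS big_split_ord big_ord_recl /= [X in _ + (X + _)]/theta_term.
rewrite addn0 leqnn subnn muln0 expr0 mulr1 addrCA; congr (_ + _).
under [LHS]eq_bigr do rewrite mulrDr.
rewrite big_split /= addrC; congr (_ + _).
  rewrite (reindex_inj rev_ord_inj) /=; apply: eq_bigr => -[j lt_jN] _ /=.
  by rewrite /theta_term leqNgt lt_jN /= subnSK.
apply: eq_bigr => j _; rewrite /theta_term /= /bump add1n leq_addr.
by rewrite addnC addnK.
Qed.

Lemma eqmodq_qXM_add n k (f : fps) : eqmodq n f 0 -> eqmodq (k + n) (q ^+ k * f) 0.
Proof.
move=> f0 i lt_i; rewrite coef_qXM; case: ltnP => // le_ki.
by apply: f0; rewrite ltn_subLR.
Qed.

(** A Gaussian binomial tends to 1 / E(q^m) when both indices grow; the modulus records the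
    speed. *)
Lemma eqmodq_Eq_qbinom m i j : (0 < m)%N ->
  eqmodq (minn i j).+1 (Eq m * qbinom m i j) 1.
Proof.
move=> m_gt0; set n := (minn i j).+1; have UE k := Eprod_unit k m_gt0.
have eqE k : (n <= k.+1)%N -> eqmodq n (Eprod m k) (Eq m).
  by move=> le_nk; apply: eqmodq_le le_nk _; apply: eqmodq_Eprod.
have -> : 1 = Eq m * (Eq m / (Eq m * Eq m)) :> fps.
  have U : Eq m * Eq m \is a GRing.unit by rewrite unitrM Eq_unit.
  by rewrite mulrA mulrV.
apply: eqmodqM; first by [].
apply: eqmodqM; first by apply: eqE; rewrite /n; lia.
apply: eqmodqV; first by rewrite unitrM !UE.
  by rewrite unitrM Eq_unit.
by apply: eqmodqM; apply: eqE; rewrite /n; lia.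
Qed.

(** The quadratic exponent alone makes the term of index n = j - N divisible by q^(|n|-1), as
    p(p-1)/2 >= p - 1. *)
Lemma theta_term_div m a b N j : (0 < m)%N ->
  exists h, theta_term m a b N j = q ^+ (maxn (j - N) (N - j)).-1 * h.
Proof.
move=> m_gt0; have bin_ge p : (p.-1 <= m * 'C(p, 2))%N.
  by case: p => //= p; rewrite binS bin1; nia.
have divq p (f : fps) : exists h, q ^+ (m * 'C(p, 2)) * f = q ^+ p.-1 * h.
  by exists (q ^+ (m * 'C(p, 2) - p.-1) * f); rewrite mulrA -exprD subnKC.
rewrite /theta_term; case: leqP => le_Nj.
  by rewrite (_ : maxn _ _ = j - N)%N //; lia.
by rewrite (_ : maxn _ _ = N - j)%N //; lia.
Qed.

(** Multiply the finite identity with M = N by E(q^m) and compare it with the partial theta sum term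
    by term. *)
Lemma jacobi_triple_product m (a b F : fps) : (0 < m)%N -> a * b = q ^+ m ->
  fps_cvg (fun N => \prod_(k < N) ((1 + a * q ^+ (m * k)) * (1 + b * q ^+ (m * k)))) F ->
  fps_cvg (theta m a b) (Eq m * F).
Proof.
move=> m_gt0 abE cvgF n.
have [M HM] := fps_cvgM (fps_cvg_cst (Eq m)) cvgF n.
exists (maxn M n) => N; rewrite geq_max => /andP[/HM HN le_nN].
apply: eqmodq_trans HN; rewrite big_split /= jacobi_finite // thetaE big_distrr /=.
move=> i lt_in; rewrite !fps_sumE; apply: eq_bigr => j _.
have [h ->] := theta_term_div a b N j m_gt0; set e := (_.-1).
apply/eqP; rewrite eq_sym -subr_eq0 -fpsBE; apply/eqP.
rewrite mulrA -[X in _ - X]mul1r -mulrBl mulrCA -[RHS](fps0E i).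
(* The error in term j has order at least min(j, 2N-j) + 1 from the binomial, plus |j-N| - 1 (or 0
   if j = N) from the theta term, hence at least N in total. *)
apply: (@eqmodq_qXM_add (minn j (N + N - j)).+1); last first.
  by have := ltn_ord j; rewrite /e; lia.
rewrite -[X in eqmodq _ _ X](mul0r h); apply: eqmodqM => // l lt_l.
by rewrite fpsBE (eqmodq_Eq_qbinom m_gt0 lt_l) subrr.
Qed.

(** Grouping [c] consecutive factors and isolating q^k makes an identity of products checkable block
    by block, as a polynomial identity in q and q^k. *)
Lemma Eprod_blocks m c N : Eprod m (c * N) =
  \prod_(k < N) \prod_(i < c) (1 - (q ^+ k) ^+ (m * c) * q ^+ (m * i.+1)).
Proof.
elim: N => [|N IHN]; first by rewrite muln0 /Eprod !big_ord0.
rewrite big_ord_recr /= -IHN mulnSr /Eprod big_split_ord /=; congr (_ * _).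
apply: eq_bigr => i _; rewrite -exprM -exprD; congr (1 - q ^+ _); lia.
Qed.

Lemma Eprod_ones m N : Eprod m N =
  \prod_(k < N) (1 - (q ^+ k) ^+ m * q ^+ m).
Proof.
by apply: eq_bigr => k _; rewrite -exprM -exprD; congr (1 - q ^+ _); lia.
Qed.

Lemma fps_cvg_quot (u v w : nat -> fps) f g : (forall n, v n \is a GRing.unit) ->
  g \is a GRing.unit -> (forall n, w n * v n = u n) ->
  fps_cvg u f -> fps_cvg v g -> fps_cvg w (f / g).
Proof.
move=> Uv Ug wv uf vg; apply: eq_fps_cvg (fps_cvgM uf (fps_cvgV Uv Ug vg)) => n.
by rewrite -wv mulrK.
Qed.

Lemma cvg_Eprod_mul m c : (0 < m)%N -> (0 < c)%N ->
  fps_cvg (fun N => Eprod m (c * N)) (Eq m).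
Proof. by move=> m_gt0 c_gt0; apply: fps_cvg_sub (cvg_Eprod m_gt0) => n; nia. Qed.

Definition thetaq m (e : fps) s t := theta m (e * q ^+ s) (e * q ^+ t).

Lemma thetaq0 m e s t : thetaq m e s t 0 = 1.
Proof. by rewrite /thetaq /theta big_ord0 addr0. Qed.

Lemma thetaqS m e s t N : thetaq m e s t N.+1 = thetaq m e s t N +
  e ^+ N.+1 * (q ^+ (m * 'C(N.+1, 2) + s * N.+1) + q ^+ (m * 'C(N.+1, 2) + t * N.+1)).
Proof.
rewrite /thetaq /theta big_ord_recr /= addrA; congr (_ + _).
by rewrite !exprMn !exprD !exprM; ring.
Qed.

Lemma cvg_thetaq m e s t F : (0 < m)%N -> e ^+ 2 = 1 -> (s + t = m)%N ->
  fps_cvg (fun N => \prod_(k < N)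
    ((1 + e * q ^+ s * (q ^+ k) ^+ m) * (1 + e * q ^+ t * (q ^+ k) ^+ m))) F ->
  fps_cvg (thetaq m e s t) (Eq m * F).
Proof.
move=> m_gt0 e2 stm cvgF; apply: jacobi_triple_product => //.
  by rewrite mulrACA -expr2 e2 mul1r -exprD stm.
apply: eq_fps_cvg cvgF => N; apply: eq_bigr => k _.
by rewrite mulnC exprM.
Qed.

Lemma sqrN1 : (-1 : fps) ^+ 2 = 1. Proof. by rewrite sqrrN expr1n. Qed.

(** * Dissections of theta series *)

(** [phi m] and [psi m] are Ramanujan's theta functions phi(-q^m) and psi(q^m). [Omega] is the sum
    of (-1)^n q^(3n^2-2n) and [Afun] the sum of q^(n(3n+1)/2), over all integers n; they appear as
    components of the 3-dissections. *)
Definition phi m : fps := Eq m ^+ 2 / Eq (2 * m).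
Definition psi m : fps := Eq (2 * m) ^+ 2 / Eq m.
Definition Omega : fps := Eq 1 * Eq 6 ^+ 2 / (Eq 2 * Eq 3).
Definition Afun : fps := Eq 2 * Eq 3 ^+ 2 / (Eq 1 * Eq 6).

Ltac unit_Eq := rewrite ?(unitrM, unitrX, Eq_unit, Eprod_unit) //.
Ltac blocks :=
  rewrite -?big_split; apply: eq_bigr => k _ /=;
  rewrite ?big_ord_recr ?big_ord0 /=; ring.

Lemma cvg_phi : fps_cvg (thetaq 2 (-1) 1 1) (phi 1).
Proof.
have -> : phi 1 = Eq 2 * (Eq 1 ^+ 2 / Eq 2 ^+ 2).
  apply: (@mulIr _ (Eq 2)); first by unit_Eq.
  rewrite /phi muln1 divrK; unit_Eq; rewrite mulrAC mulrCA -expr2 divrr ?mulr1; unit_Eq.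
apply: cvg_thetaq => //; first exact: sqrN1.
apply: (@fps_cvg_quot (fun N => Eprod 1 (2 * N) ^+ 2) (fun N => Eprod 2 N ^+ 2)).
- by move=> N; unit_Eq.
- by unit_Eq.
- move=> N; rewrite Eprod_blocks Eprod_ones !expr2; blocks.
- by apply: fps_cvgX; apply: cvg_Eprod_mul.
- by apply: fps_cvgX; apply: cvg_Eprod.
Qed.

Lemma cvg_psi : fps_cvg (thetaq 4 1 1 3) (psi 1).
Proof.
have -> : psi 1 = Eq 4 * (Eq 2 * Eq 2 / (Eq 1 * Eq 4)).
  apply: (@mulIr _ (Eq 1 * Eq 4)); first by unit_Eq.
  rewrite -[RHS]mulrA divrK; unit_Eq; rewrite /psi muln1 mulrA divrK; unit_Eq; rewrite expr2; ring.
apply: cvg_thetaq => //; first exact: expr1n.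
(* The lengths are chosen so that numerator and denominator agree in each block, through (1 + q^j)(1
   - q^j) = 1 - q^(2j) for j = 4k+1 and j = 4k+3. *)
apply: (@fps_cvg_quot (fun N => Eprod 2 (4 * N) * Eprod 2 (2 * N))
  (fun N => Eprod 1 (4 * N) * Eprod 4 (2 * N))).
- by move=> N; unit_Eq.
- by unit_Eq.
- move=> N; rewrite !Eprod_blocks; blocks.
- by apply: fps_cvgM; apply: cvg_Eprod_mul.
- by apply: fps_cvgM; apply: cvg_Eprod_mul.
Qed.

Lemma cvg_Omega : fps_cvg (thetaq 6 (-1) 1 5) Omega.
Proof.
have -> : Omega = Eq 6 * (Eq 1 * Eq 6 / (Eq 2 * Eq 3)).
  by rewrite /Omega mulrA; congr (_ / _); ring.
apply: cvg_thetaq => //; first exact: sqrN1.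
(* Inclusion and exclusion: removing the multiples of 2 and of 3 and restoring those of 6 leaves the
   exponents 1 and 5 mod 6. *)
apply: (@fps_cvg_quot (fun N => Eprod 1 (6 * N) * Eprod 6 N)
  (fun N => Eprod 2 (3 * N) * Eprod 3 (2 * N))).
- by move=> N; unit_Eq.
- by unit_Eq.
- move=> N; rewrite (Eprod_ones 6) !Eprod_blocks; blocks.
- by apply: fps_cvgM; [apply: cvg_Eprod_mul | apply: cvg_Eprod].
- by apply: fps_cvgM; apply: cvg_Eprod_mul.
Qed.

Lemma cvg_Afun : fps_cvg (thetaq 3 1 1 2) Afun.
Proof.
have -> : Afun = Eq 3 * (Eq 2 * Eq 3 / (Eq 1 * Eq 6)).
  by rewrite /Afun mulrA; congr (_ / _); ring.
apply: cvg_thetaq => //; first exact: expr1n.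
apply: (@fps_cvg_quot (fun N => Eprod 2 (3 * N) * Eprod 3 N)
  (fun N => Eprod 1 (3 * N) * Eprod 6 N)).
- by move=> N; unit_Eq.
- by unit_Eq.
- move=> N; rewrite (Eprod_ones 6) (Eprod_ones 3) !Eprod_blocks; blocks.
- by apply: fps_cvgM; [apply: cvg_Eprod_mul | apply: cvg_Eprod].
- by apply: fps_cvgM; [apply: cvg_Eprod_mul | apply: cvg_Eprod].
Qed.

Lemma bin2S n : 'C(n.+1, 2) = ('C(n, 2) + n)%N. Proof. by rewrite binS bin1. Qed.

Lemma bin2_double n : (2 * 'C(n, 2) + n = n * n)%N.
Proof. by elim: n => // n IHn; rewrite bin2S; lia. Qed.

Lemma dil9_qX e : dil3 (dil3 (q ^+ e)) = q ^+ (9 * e).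
Proof. rewrite !rmorphXn /= dil3_q rmorphXn /= dil3_q -!exprM; congr (q ^+ _); lia. Qed.

Lemma thetaq_phiS N : thetaq 2 (-1) 1 1 N.+1 =
  thetaq 2 (-1) 1 1 N + 2 * (-1) ^+ N.+1 * q ^+ (N.+1 * N.+1).
Proof. by rewrite thetaqS mul1n bin2_double; ring. Qed.

Lemma thetaq_OmegaS N : q * dil3 (thetaq 6 (-1) 1 5 N.+1) =
  q * dil3 (thetaq 6 (-1) 1 5 N)
  + (-1) ^+ N.+1 * (q ^+ ((3 * N + 2) * (3 * N + 2)) + q ^+ ((3 * N + 4) * (3 * N + 4))).
Proof.
rewrite thetaqS !(rmorphD, rmorphM, rmorphXn, rmorphN, rmorph1) /= dil3_q -!exprM mulrDr.
congr (_ + _); rewrite mulrCA mulrDr -!exprS; congr (_ * (q ^+ _ + q ^+ _)).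
  by have := bin2_double N.+1; nia.
by have := bin2_double N.+1; nia.
Qed.

Lemma thetaq_phi9S N : dil3 (dil3 (thetaq 2 (-1) 1 1 N.+1)) =
  dil3 (dil3 (thetaq 2 (-1) 1 1 N))
  + 2 * (-1) ^+ N.+1 * q ^+ ((3 * N + 3) * (3 * N + 3)).
Proof.
rewrite thetaq_phiS !rmorphD !rmorphM /= dil9_qX !(rmorph_nat, rmorph_sign) /=.
by congr (_ + _ * q ^+ _); lia.
Qed.

(** The exponents on the left are the squares n^2 with |n| <= 3N+1. Multiples of 3 give the series
    in q^9, and the other n give q Omega(q^3), since 3(3n^2-2n) + 1 = (3n-1)^2. *)
Lemma thetaq_phi_dissect N : thetaq 2 (-1) 1 1 (3 * N).+1 =
  dil3 (dil3 (thetaq 2 (-1) 1 1 N)) - 2 * (q * dil3 (thetaq 6 (-1) 1 5 N)).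
Proof.
elim: N => [|N IHN].
  by rewrite muln0 thetaq_phiS !thetaq0 !rmorph1; ring.
rewrite (_ : 3 * N.+1 = (3 * N).+3)%N; last by lia.
rewrite thetaq_OmegaS thetaq_phi9S [LHS]thetaq_phiS.
rewrite [thetaq 2 _ _ _ (3 * N).+3]thetaq_phiS [thetaq 2 _ _ _ (3 * N).+2]thetaq_phiS.
rewrite IHN (_ : (3 * N).+4 = 3 * N + 4)%N; last by lia.
rewrite (_ : (3 * N).+3 = 3 * N + 3)%N; last by lia.
rewrite (_ : (3 * N).+2 = 3 * N + 2)%N; last by lia.
rewrite ![(-1) ^+ (3 * N + _)]exprD !exprM (_ : (-1) ^+ 3 = -1 :> fps); last by ring.
rewrite [_ ^+ N.+1]exprS; ring.
Qed.

Lemma thetaq_psiS N : thetaq 4 1 1 3 N.+1 =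
  thetaq 4 1 1 3 N + q ^+ 'C((2 * N).+2, 2) + q ^+ 'C((2 * N).+3, 2).
Proof.
rewrite thetaqS expr1n mul1r -[RHS]addrA; congr (_ + (q ^+ _ + q ^+ _)).
  by have := bin2_double N.+1; have := bin2_double (2 * N).+2; nia.
by have := bin2_double N.+1; have := bin2_double (2 * N).+3; nia.
Qed.

Lemma thetaq_AfunS N : dil3 (thetaq 3 1 1 2 N.+1) =
  dil3 (thetaq 3 1 1 2 N) + q ^+ 'C((3 * N).+3, 2) + q ^+ 'C((3 * N).+4, 2).
Proof.
rewrite thetaqS expr1n mul1r !(rmorphD, rmorphXn) /= dil3_q -!exprM -[RHS]addrA.
congr (_ + (q ^+ _ + q ^+ _)).
  by have := bin2_double N.+1; have := bin2_double (3 * N).+3; nia.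
by have := bin2_double N.+1; have := bin2_double (3 * N).+4; nia.
Qed.

Lemma thetaq_psi9S N : q * dil3 (dil3 (thetaq 4 1 1 3 N.+1)) =
  q * dil3 (dil3 (thetaq 4 1 1 3 N)) + q ^+ 'C(6 * N + 5, 2) + q ^+ 'C(6 * N + 8, 2).
Proof.
rewrite thetaqS expr1n mul1r !rmorphD /= !dil9_qX !mulrDr -!exprS -[RHS]addrA.
congr (_ + (q ^+ _ + q ^+ _)).
  by have := bin2_double N.+1; have := bin2_double (6 * N + 5); nia.
by have := bin2_double N.+1; have := bin2_double (6 * N + 8); nia.
Qed.

(** The exponents are the triangular numbers j(j-1)/2: j = 0, 1 mod 3 belong to Afun(q^3) and j = 2
    mod 3 to q psi(q^9). The left truncation stops at j = 6N+3 and the right one at j = 6N+4, hence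
    the extra term, which vanishes in the limit. *)
Lemma thetaq_psi_dissect N :
  thetaq 4 1 1 3 (3 * N).+1 + q ^+ 'C(6 * N + 4, 2) =
  dil3 (thetaq 3 1 1 2 (2 * N).+1) + q * dil3 (dil3 (thetaq 4 1 1 3 N)).
Proof.
elim: N => [|N IHN].
  rewrite !muln0 thetaq_psiS thetaq_AfunS !thetaq0 !rmorph1 !muln0 /= !expr1; ring.
rewrite (_ : 3 * N.+1 = (3 * N).+3)%N; last by lia.
rewrite (_ : 2 * N.+1 = (2 * N).+2)%N; last by lia.
rewrite thetaq_psi9S 2!thetaq_AfunS 3!thetaq_psiS.
have /eqP := IHN; rewrite -subr_eq0 => /eqP {}IHN.
apply/eqP; rewrite -subr_eq0 -IHN; apply/eqP.
rewrite (_ : (2 * (3 * N).+1).+3 = 6 * N + 5)%N; last by lia.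
rewrite (_ : (2 * (3 * N).+1).+2 = 6 * N + 4)%N; last by lia.
rewrite (_ : (2 * (3 * N).+2).+3 = 6 * N + 7)%N; last by lia.
rewrite (_ : (2 * (3 * N).+2).+2 = 6 * N + 6)%N; last by lia.
rewrite (_ : (2 * (3 * N).+3).+3 = 6 * N + 9)%N; last by lia.
rewrite (_ : (2 * (3 * N).+3).+2 = 6 * N + 8)%N; last by lia.
rewrite (_ : (3 * (2 * N).+1).+4 = 6 * N + 7)%N; last by lia.
rewrite (_ : (3 * (2 * N).+1).+3 = 6 * N + 6)%N; last by lia.
rewrite (_ : (3 * (2 * N).+2).+4 = 6 * N + 10)%N; last by lia.
rewrite (_ : (3 * (2 * N).+2).+3 = 6 * N + 9)%N; last by lia.
rewrite (_ : 6 * N.+1 + 4 = 6 * N + 10)%N; last by lia.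
ring.
Qed.

Lemma dil3_phi m : (0 < m)%N -> dil3 (phi m) = phi (3 * m).
Proof.
move=> m_gt0; have m2_gt0 : (0 < 2 * m)%N by rewrite muln_gt0.
rewrite /phi rmorph_div ?rmorphXn /= ?dil3_Eq //; last exact: Eq_unit.
by rewrite mulnCA.
Qed.

Lemma dil3_psi m : (0 < m)%N -> dil3 (psi m) = psi (3 * m).
Proof.
move=> m_gt0; have m2_gt0 : (0 < 2 * m)%N by rewrite muln_gt0.
rewrite /psi rmorph_div ?rmorphXn /= ?dil3_Eq //; last exact: Eq_unit.
by rewrite mulnCA.
Qed.

Lemma phi_dissect : phi 1 = phi 9 - 2 * (q * dil3 Omega).
Proof.
have les n : (n <= (3 * n).+1)%N by lia.
apply: (fps_cvg_uniq (fps_cvg_sub les cvg_phi)).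
rewrite -[phi 9](dil3_phi (m := 3)) // -[phi 3](dil3_phi (m := 1)) //.
apply: (@eq_fps_cvg (fun N => _)) => [N|]; first by rewrite thetaq_phi_dissect.
apply: fps_cvgD; first by do 2 apply: fps_cvg_dil3; apply: cvg_phi.
apply/fps_cvgN/fps_cvgM; first exact: fps_cvg_cst.
apply: fps_cvgM; first exact: fps_cvg_cst.
by apply: fps_cvg_dil3; apply: cvg_Omega.
Qed.

Lemma psi_dissect : psi 1 = dil3 Afun + q * psi 9.
Proof.
have les n : (n <= (3 * n).+1)%N by lia.
have les2 n : (n <= (2 * n).+1)%N by lia.
have cvg0 : fps_cvg (fun N => q ^+ 'C(6 * N + 4, 2)) 0.
  move=> n; exists n => N le_nN; rewrite -[q ^+ _]mulr1; apply: eqmodq_qXM.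
  by have := bin2_double (6 * N + 4); nia.
rewrite -[LHS]addr0.
apply: (fps_cvg_uniq (fps_cvgD (fps_cvg_sub les cvg_psi) cvg0)).
rewrite -[psi 9](dil3_psi (m := 3)) // -[psi 3](dil3_psi (m := 1)) //.
apply: (@eq_fps_cvg (fun N => _)) => [N|]; first by rewrite thetaq_psi_dissect.
apply: fps_cvgD.
  by apply: fps_cvg_dil3; apply: fps_cvg_sub les2 cvg_Afun.
apply: fps_cvgM; first exact: fps_cvg_cst.
by do 2 apply: fps_cvg_dil3; apply: cvg_psi.
Qed.

(** * Computable integer polynomials *)

Definition Zr {R : pzRingType} (z : Z) : R := (int_of_Z z)%:~R.

Lemma ZrD R : {morph @Zr R : x y / (x + y)%BZ >-> x + y}.
Proof. by move=> x y; rewrite /Zr -intrD; congr (_%:~R); lia. Qed.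

Lemma ZrM R : {morph @Zr R : x y / (x * y)%BZ >-> x * y}.
Proof. by move=> x y; rewrite /Zr -intrM; congr (_%:~R); lia. Qed.

Lemma zqE z : zq z = Zr z.
Proof.
case: z => [|p|p] //; first by rewrite /Zr /= -[RHS]/(_%:R); congr (_%:R); lia.
rewrite /zq -[RHS]/((int_of_Z (Z.neg p))%:~R) pmulrn -mulrNz; congr (_%:~R); lia.
Qed.

(* Polynomials with binary integer coefficients, lowest degree first, so that
   the polynomial identities of the proof can be checked by computation. *)
Definition Zpoly := seq Z.

Fixpoint Zpoly_add (s t : Zpoly) : Zpoly :=
  match s, t with
  | x :: s', y :: t' => (x + y)%BZ :: Zpoly_add s' t'
  | [::], _ => t
  | _, [::] => s
  end.

Definition Zpoly_mul (s t : Zpoly) : Zpoly :=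
  foldr (fun x r => Zpoly_add (map (Z.mul x) t) (0%BZ :: r)) [::] s.

Definition Zpoly_pow (s : Zpoly) k : Zpoly := iter k (Zpoly_mul s) [:: 1%BZ].

Definition Zpoly_comp (s t : Zpoly) : Zpoly :=
  foldr (fun x r => Zpoly_add [:: x] (Zpoly_mul t r)) [::] s.

(** Testing the difference for zero entries makes trailing zeros harmless. *)
Definition Zpoly_eqb (s t : Zpoly) :=
  all (Z.eqb 0) (Zpoly_add s (map (Z.mul (-1)) t)).

Fixpoint Zpoly_split3 (s : Zpoly) : Zpoly * Zpoly * Zpoly :=
  if s is x :: s' then
    let: (u, v, w) := Zpoly_split3 s' in (x :: w, u, v)
  else ([::], [::], [::]).

Section ZpolyEval.

Variable R : comPzRingType.
Implicit Types (x : R) (s t : Zpoly).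

Definition Zeval x s : R := foldr (fun z y => Zr z + x * y) 0 s.
Arguments Zeval x s : simpl never.

Lemma Zeval_cons x z s : Zeval x (z :: s) = Zr z + x * Zeval x s.
Proof. by []. Qed.

Lemma Zeval_scale x z s : Zeval x (map (Z.mul z) s) = Zr z * Zeval x s.
Proof.
elim: s => [|y s IHs]; first by rewrite mulr0.
by rewrite /= !Zeval_cons IHs ZrM; ring.
Qed.

Lemma Zeval_add x s t : Zeval x (Zpoly_add s t) = Zeval x s + Zeval x t.
Proof.
elim: s t => [|y s IHs] [|z t]; rewrite ?add0r ?addr0 //.
by rewrite /= !Zeval_cons IHs ZrD; ring.
Qed.

Lemma Zeval_mul x s t : Zeval x (Zpoly_mul s t) = Zeval x s * Zeval x t.
Proof.
elim: s => [|y s IHs]; first by rewrite mul0r.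
by rewrite /= Zeval_add Zeval_scale !Zeval_cons IHs {2}/Zr mulr0z; ring.
Qed.

Lemma Zeval1 x : Zeval x [:: 1%BZ] = 1.
Proof. by rewrite /Zeval /= mulr0 addr0. Qed.

Lemma Zeval_pow x s k : Zeval x (Zpoly_pow s k) = Zeval x s ^+ k.
Proof.
elim: k => [|k IHk]; first exact: Zeval1.
by rewrite exprS -IHk -Zeval_mul.
Qed.

Lemma Zeval_comp x s t : Zeval x (Zpoly_comp s t) = Zeval (Zeval x t) s.
Proof.
elim: s => [|y s IHs] //.
by rewrite [LHS]Zeval_add Zeval_mul IHs !Zeval_cons mulr0 addr0.
Qed.

Lemma Zeval_eqb x s t : Zpoly_eqb s t -> Zeval x s = Zeval x t.
Proof.
move=> eq_st; have: Zeval x (Zpoly_add s (map (Z.mul (-1)) t)) = 0.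
  move: eq_st; rewrite /Zpoly_eqb; elim: (Zpoly_add _ _) => //= z r IHr.
  case/andP=> z0 /IHr Zr0; have <- : Z0 = z by apply/Z.eqb_eq.
  rewrite Zeval_cons Zr0.
  by rewrite mulr0 addr0.
rewrite Zeval_add Zeval_scale (_ : Zr (-1) = -1) // mulN1r => /eqP.
by rewrite subr_eq0 => /eqP.
Qed.

(** The reciprocal polynomial: it turns a polynomial in X into one in 1/X = 1 - 8c. The extra factor
    [x] on the left allows [size s] in place of the degree. *)
Lemma Zeval_rev x y s : x * y = 1 ->
  x * Zeval x s = x ^+ size s * Zeval y (rev s).
Proof.
move=> xy1; have Zeval_rcons r z : Zeval y (rcons r z) = Zeval y r + y ^+ size r * Zr z.
  elim: r => [|u r IHr]; first by rewrite /Zeval /= mulr0 add0r mul1r addr0.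
  by rewrite rcons_cons !Zeval_cons IHr /= exprS; ring.
elim: s => [|z s IHs]; first by rewrite /Zeval /= !mulr0.
rewrite Zeval_cons mulrDr IHs rev_cons Zeval_rcons size_rev /= exprS.
have <- : x ^+ size s * y ^+ size s * (x * Zr z) = x * Zr z.
  by rewrite -exprMn xy1 expr1n mul1r.
ring.
Qed.

End ZpolyEval.

(** * Expansions in [afun] and [cfun] *)

Definition gfun : fps := Eq 1 * Eq 6 ^+ 3 / (Eq 2 * Eq 3 ^+ 3).
Definition afun : fps := q * dil3 gfun.
Definition cfun : fps := q * gfun ^+ 3.

Lemma gfun_unit : gfun \is a GRing.unit.
Proof. by rewrite /gfun unitrM unitrV; unit_Eq. Qed.

Lemma afun3 : afun ^+ 3 = dil3 cfun.
Proof. by rewrite /afun /cfun [RHS]rmorphM /= [dil3 (_ ^+ 3)]rmorphXn /= dil3_q exprMn. Qed.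

Lemma Zr_dil3 z : dil3 (Zr z) = Zr z.
Proof. exact: rmorph_int. Qed.

Lemma Zeval_split3 s : let: (u, v, w) := Zpoly_split3 s in
  Zeval afun s = dil3 (Zeval cfun u) + afun * dil3 (Zeval cfun v)
                 + afun ^+ 2 * dil3 (Zeval cfun w).
Proof.
elim: s => [|z s]; first by rewrite /Zeval /= rmorph0; ring.
rewrite /=; case: (Zpoly_split3 s) => [[u v] w] IHs.
by rewrite !Zeval_cons IHs rmorphD /= rmorphM /= Zr_dil3 -afun3; ring.
Qed.

(** Since a = q g(q^3) and a^3 = c(q^3), only exponents 2 mod 3 of a contribute, and a^2 leaves the
    factor g^2. *)
Lemma sect3_Zeval s h :
  sect3 2 (Zeval afun s * dil3 h) = gfun ^+ 2 * Zeval cfun (Zpoly_split3 s).2 * h.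
Proof.
move: (Zeval_split3 s); case: (Zpoly_split3 s) => [[u v] w] -> /=.
have [_ _ <-] := sect3_join (Zeval cfun u * h) (gfun * Zeval cfun v * h)
  (gfun ^+ 2 * Zeval cfun w * h).
by congr sect3; rewrite /afun !rmorphM /=; ring.
Qed.

(** * Relations between phi, psi, X and xi *)

Lemma phi_unit m : (0 < m)%N -> phi m \is a GRing.unit.
Proof. by move=> m_gt0; rewrite /phi unitrM unitrV; unit_Eq; rewrite muln_gt0. Qed.

Lemma psi_unit m : (0 < m)%N -> psi m \is a GRing.unit.
Proof. by move=> m_gt0; rewrite /psi unitrM unitrV; unit_Eq; rewrite muln_gt0. Qed.

Lemma phiE m : (0 < m)%N -> phi m * Eq (2 * m) = Eq m ^+ 2.
Proof. by move=> m_gt0; rewrite /phi divrK //; unit_Eq; rewrite muln_gt0. Qed.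

Lemma psiE m : (0 < m)%N -> psi m * Eq m = Eq (2 * m) ^+ 2.
Proof. by move=> m_gt0; rewrite /psi divrK //; unit_Eq. Qed.

Lemma gfunE : gfun * (Eq 2 * Eq 3 ^+ 3) = Eq 1 * Eq 6 ^+ 3.
Proof. by rewrite /gfun divrK //; unit_Eq. Qed.

Lemma Omega_gfun : Omega = phi 3 * gfun.
Proof.
have OE : Omega * (Eq 2 * Eq 3) = Eq 1 * Eq 6 ^+ 2 by rewrite /Omega divrK //; unit_Eq.
have U : Eq 2 * Eq 3 ^+ 3 * Eq 6 \is a GRing.unit by unit_Eq.
apply: (mulIr U).
transitivity (Omega * (Eq 2 * Eq 3) * (Eq 3 ^+ 2 * Eq 6)); first by ring.
transitivity ((phi 3 * Eq 6) * (gfun * (Eq 2 * Eq 3 ^+ 3))); last by ring.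
by rewrite OE (phiE (m := 3)) // gfunE; ring.
Qed.

Lemma Afun_gfun : Afun * gfun = psi 3.
Proof.
have AE : Afun * (Eq 1 * Eq 6) = Eq 2 * Eq 3 ^+ 2 by rewrite /Afun divrK //; unit_Eq.
have U : Eq 1 * Eq 2 * Eq 3 ^+ 3 * Eq 6 \is a GRing.unit by unit_Eq.
apply: (mulIr U).
transitivity ((Afun * (Eq 1 * Eq 6)) * (gfun * (Eq 2 * Eq 3 ^+ 3))); first by ring.
transitivity ((psi 3 * Eq 3) * (Eq 1 * Eq 2 * Eq 3 ^+ 2 * Eq 6)); last by ring.
by rewrite AE (psiE (m := 3)) // gfunE; ring.
Qed.

Lemma phi_afun : phi 1 = phi 9 * (1 - 2 * afun).
Proof.
rewrite phi_dissect -[phi 9](dil3_phi (m := 3)) // Omega_gfun [dil3 (_ * _)]rmorphM /= /afun.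
by ring.
Qed.

Lemma psi_afun : psi 1 * dil3 gfun = psi 9 * (1 + afun).
Proof.
rewrite psi_dissect -[psi 9](dil3_psi (m := 3)) // mulrDl -rmorphM /= Afun_gfun /afun.
by ring.
Qed.

(** The norm is multiplicative and sends E_m to E_m^4 / E_3m for m = 1, 2; apply it to phi_1 E_2 =
    E_1^2. *)
Lemma norm3_phi : norm3 (phi 1) * phi 3 = phi 1 ^+ 4.
Proof.
have U : (norm3 (Eq 2) * Eq 6) * Eq 6 ^+ 2 * Eq 3 ^+ 2 \is a GRing.unit.
  by rewrite (norm3_Eq (m := 2)) //; unit_Eq.
apply: (mulIr U).
transitivity (norm3 (phi 1 * Eq 2) * (phi 3 * Eq 6) * Eq 6 ^+ 2 * Eq 3 ^+ 2).
  by rewrite norm3M; ring.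
rewrite (phiE (m := 1)) // (phiE (m := 3)) // (norm3_Eq (m := 2)) //.
transitivity ((phi 1 * Eq 2) ^+ 4 * Eq 6 ^+ 2 * Eq 3 ^+ 2); last by ring.
rewrite (phiE (m := 1)) // !expr2 norm3M.
transitivity ((norm3 (Eq 1) * Eq 3) ^+ 2 * Eq 6 ^+ 2 * Eq 3 ^+ 2); first by ring.
by rewrite (norm3_Eq (m := 1)) //; ring.
Qed.

(** By the dissection, the norm of phi_1 is also phi_3^3 - 8 q Omega^3, and Omega = phi_3 g. *)
Lemma phi_cfun : phi 1 ^+ 4 = phi 3 ^+ 4 * (1 - 8 * cfun).
Proof.
rewrite -norm3_phi phi_dissect -[phi 9](dil3_phi (m := 3)) //.
rewrite (_ : _ - _ = dil3 (phi 3) + q * dil3 (- (2 * Omega))).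
  by rewrite norm3_join Omega_gfun /cfun; ring.
by rewrite [dil3 (- _)]rmorphN /= [dil3 (2 * _)]rmorphM /= rmorph_nat; ring.
Qed.

Lemma Xs_phi : Xs * phi 1 ^+ 4 = phi 3 ^+ 4.
Proof.
have XE : Xs * (Eq 1 ^+ 8 * Eq 6 ^+ 4) = Eq 2 ^+ 4 * Eq 3 ^+ 8.
  by rewrite /Xs fps_divE !fps_powE !fps_mul_def ?divrK //; unit_Eq.
have U : Eq 2 ^+ 4 * Eq 6 ^+ 4 \is a GRing.unit by unit_Eq.
apply: (mulIr U).
transitivity (Xs * (phi 1 * Eq 2) ^+ 4 * Eq 6 ^+ 4); first by ring.
transitivity ((phi 3 * Eq 6) ^+ 4 * Eq 2 ^+ 4); last by ring.
rewrite (phiE (m := 1)) // (phiE (m := 3)) //.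
transitivity (Xs * (Eq 1 ^+ 8 * Eq 6 ^+ 4)); first by ring.
by rewrite XE; ring.
Qed.

Lemma Xs_cfun : Xs * (1 - 8 * cfun) = 1.
Proof.
have U : phi 3 ^+ 4 \is a GRing.unit by rewrite unitrX ?phi_unit.
by apply: (mulIr U); rewrite mul1r -mulrA [_ * phi 3 ^+ 4]mulrC -phi_cfun Xs_phi.
Qed.

Lemma dil3_1B8cfun : dil3 (1 - 8 * cfun) = 1 - 8 * afun ^+ 3.
Proof.
by rewrite [LHS]rmorphB /= rmorph1 [dil3 (8 * _)]rmorphM /= rmorph_nat afun3.
Qed.

Lemma dil3_Xs : dil3 Xs * (1 - 8 * afun ^+ 3) = 1.
Proof.
have := congr1 dil3 Xs_cfun.
by rewrite [LHS]rmorphM /= dil3_1B8cfun rmorph1.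
Qed.

Lemma Xs_afun : Xs * (1 - 2 * afun) ^+ 4 = 1 - 8 * afun ^+ 3.
Proof.
have U : phi 9 ^+ 4 \is a GRing.unit by rewrite unitrX ?phi_unit.
apply: (mulIr U).
transitivity (Xs * (phi 9 * (1 - 2 * afun)) ^+ 4); first by ring.
rewrite -phi_afun Xs_phi -[phi 3](dil3_phi (m := 1)) // -[phi 9](dil3_phi (m := 3)) //.
by rewrite -!rmorphXn /= phi_cfun [LHS]rmorphM /= dil3_1B8cfun mulrC.
Qed.

Lemma xi_afun : xi.2 * (dil3 gfun ^+ 2 * (1 - 2 * afun)) = (1 + afun) ^+ 2.
Proof.
have xiE : xi.2 * (Eq 1 ^+ 4 * Eq 18 ^+ 5) = Eq 2 ^+ 5 * Eq 9 ^+ 4.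
  by rewrite /xi /snd fps_divE !fps_powE !fps_mul_def ?divrK //; unit_Eq.
(* In terms of theta functions, q^2 xi = psi_1^2 phi_9 / (phi_1 psi_9^2), so the two dissections
   apply. *)
have xi_phi : xi.2 * phi 1 * psi 9 ^+ 2 = psi 1 ^+ 2 * phi 9.
  have U : Eq 2 * Eq 9 ^+ 2 * Eq 1 ^+ 2 * Eq 18 \is a GRing.unit by unit_Eq.
  apply: (mulIr U).
  transitivity (xi.2 * (phi 1 * Eq 2) * (psi 9 * Eq 9) ^+ 2 * Eq 1 ^+ 2 * Eq 18); first by ring.
  transitivity ((psi 1 * Eq 1) ^+ 2 * (phi 9 * Eq 18) * Eq 2 * Eq 9 ^+ 2); last by ring.
  rewrite (phiE (m := 1)) // (phiE (m := 9)) // (psiE (m := 1)) // (psiE (m := 9)) //.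
  transitivity (xi.2 * (Eq 1 ^+ 4 * Eq 18 ^+ 5)); first by ring.
  by rewrite xiE; ring.
have U : phi 9 * psi 9 ^+ 2 \is a GRing.unit by rewrite unitrM unitrX ?phi_unit ?psi_unit.
apply: (mulIr U).
transitivity (xi.2 * (phi 9 * (1 - 2 * afun)) * psi 9 ^+ 2 * dil3 gfun ^+ 2); first by ring.
rewrite -phi_afun xi_phi.
transitivity ((psi 1 * dil3 gfun) ^+ 2 * phi 9); first by ring.
by rewrite psi_afun; ring.
Qed.

(** Multiplying through by (1 + 2a + 4a^2)^(4k+1) turns the denominator (1 - 2a)^(4k+1) into (1 -
    8a^3)^(4k+1), a series in q^3. The numerator of X^k cancels k of these factors, and the other
    3k+1 give X(q^3)^(3k+1). *)
Lemma xi_Xs_expand k : xi.2 * Xs ^+ k =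
  (1 + afun) ^+ 2 * (1 + 2 * afun + 4 * afun ^+ 2) ^+ (4 * k).+1
  * dil3 (Xs ^+ (3 * k).+1 / gfun ^+ 2).
Proof.
have fact : (1 - 2 * afun) * (1 + 2 * afun + 4 * afun ^+ 2) = 1 - 8 * afun ^+ 3 by ring.
have U8 : 1 - 8 * afun ^+ 3 \is a GRing.unit.
  by apply/unitrPr; exists (dil3 Xs); rewrite mulrC dil3_Xs.
have Ua : 1 - 2 * afun \is a GRing.unit.
  by move: U8; rewrite -fact unitrM => /andP[].
have Ug : dil3 gfun \is a GRing.unit by apply: rmorph_unit gfun_unit.
have gE : dil3 (gfun ^+ 2)^-1 * dil3 gfun ^+ 2 = 1.
  by rewrite -rmorphXn -rmorphM mulVr ?rmorph1 // unitrX ?gfun_unit.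
have U : dil3 gfun ^+ 2 * (1 - 2 * afun) ^+ (4 * k).+1 \is a GRing.unit.
  by rewrite unitrM !unitrX.
apply: (mulIr U).
transitivity (xi.2 * (dil3 gfun ^+ 2 * (1 - 2 * afun)) * (Xs * (1 - 2 * afun) ^+ 4) ^+ k).
  by rewrite [_ ^+ (4 * k).+1]exprS exprM [(Xs * _) ^+ k]exprMn; ring.
rewrite xi_afun Xs_afun rmorphM.
transitivity ((1 + afun) ^+ 2 *
    ((1 - 2 * afun) * (1 + 2 * afun + 4 * afun ^+ 2)) ^+ (4 * k).+1
  * dil3 Xs ^+ (3 * k).+1 * (dil3 (gfun ^+ 2)^-1 * dil3 gfun ^+ 2)); last first.
  by rewrite exprMn rmorphXn /=; ring.
rewrite fact gE mulr1 -mulrA; congr (_ * _).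
rewrite (_ : (4 * k).+1 = k + (3 * k).+1)%N; last by lia.
by rewrite exprD -mulrA -exprMn [_ * dil3 Xs]mulrC dil3_Xs expr1n mulr1.
Qed.

Definition xi_Xs_poly k : Zpoly :=
  (Zpoly_split3 (Zpoly_mul [:: 1; 2; 1] (Zpoly_pow [:: 1; 2; 4] (4 * k).+1)))%BZ.2.

Lemma sect3_xi_Xs k :
  sect3 2 (xi.2 * Xs ^+ k) = Xs ^+ (3 * k).+1 * Zeval cfun (xi_Xs_poly k).
Proof.
rewrite xi_Xs_expand.
rewrite (_ : _ * _ ^+ (4 * k).+1 = Zeval afun
  (Zpoly_mul [:: 1; 2; 1] (Zpoly_pow [:: 1; 2; 4] (4 * k).+1))%BZ).
  rewrite sect3_Zeval -[Xs ^+ _ as X in _ = X * _](divrK (x := gfun ^+ 2)).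
    by rewrite /xi_Xs_poly; ring.
  by rewrite unitrX ?gfun_unit.
rewrite Zeval_mul Zeval_pow /Zeval /= /Zr; congr (_ * _ ^+ _); ring.
Qed.

(** After multiplication by X both sides are X^(3k+2) times a polynomial in c: on the right it is
    the reversal of [P] at 1/X = 1 - 8c. The claim thus reduces to a computable equality of integer
    polynomials. *)
Lemma sect3_xi_Xs_eval k (P : Zpoly) : size P = (3 * k).+2 ->
  Zpoly_eqb (xi_Xs_poly k) (Zpoly_comp (rev P) [:: 1; -8])%BZ ->
  sect3 2 (xi.2 * Xs ^+ k) = Zeval Xs P.
Proof.
move=> szP eqP; have UX : Xs \is a GRing.unit.
  by apply/unitrPr; exists (1 - 8 * cfun); apply: Xs_cfun.
apply: (mulrI UX); rewrite (Zeval_rev _ Xs_cfun) szP sect3_xi_Xs mulrA -exprS.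
congr (_ * _); rewrite (Zeval_eqb _ eqP) Zeval_comp; congr (Zeval _ _).
by rewrite /Zeval /= /Zr; ring.
Qed.

(** * Return to Laurent coefficients *)

Definition fpsC : rat -> fps := fps_of_poly \o polyC.

Lemma fps_pevalE p f : fps_peval p f = (map_poly fpsC p).[f].
Proof.
apply/funext => n; rewrite horner_coef size_map_poly fps_sumE; apply: eq_bigr => i _.
rewrite coef_map /= fps_powE fpsME big_ord_recl /= /fps_of_poly coefC /= subn0.
by rewrite big1 ?addr0 // => j _; rewrite coefC mul0r.
Qed.

Lemma UxiX_peval k p : sect3 2 (xi.2 * Xs ^+ k) = fps_peval p Xs -> UxiX k =1 PX p.
Proof.
move=> Ek n; rewrite /UxiX /PX /Uop /lcoef -Ek /= fps_powE fps_mul_def.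
(* For n < 0 the index 3n + 2 is negative too, so both coefficients are 0. *)
case: n => n; last first.
  by rewrite (_ : 3 * _ - _ = Negz (3 * n)) //; lia.
by rewrite (_ : 3 * _ - _ = Posz (3 * n + 2)) ?subr0 //; lia.
Qed.

Lemma fpsC_zq z : fpsC (zq z) = Zr z.
Proof. by rewrite zqE [LHS]rmorph_int. Qed.

Lemma UxiX_Zpoly k (P : Zpoly) p : size P = (3 * k).+2 ->
  Zpoly_eqb (xi_Xs_poly k) (Zpoly_comp (rev P) [:: 1; -8])%BZ ->
  p = foldr (fun z r => (zq z)%:P + 'X * r) 0 P -> UxiX k =1 PX p.
Proof.
move=> szP eqP ->; apply: UxiX_peval; rewrite (sect3_xi_Xs_eval szP eqP) fps_pevalE.
elim: P {szP eqP} => [|z P IHP]; first by rewrite rmorph0 horner0.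
rewrite Zeval_cons IHP [foldr _ _ _]/= rmorphD /= rmorphM /= map_polyX map_polyC.
by rewrite hornerD hornerM hornerX hornerC -fpsC_zq.
Qed.

Theorem theorem2p4 :
  UxiX 0 =1 PX ((zq 9)%:P * 'X) /\
  UxiX 1 =1 PX ((zq (-9))%:P * 'X + (zq 252)%:P * 'X^2 + (zq (-891))%:P * 'X^3
                + (zq 729)%:P * 'X^4) /\
  UxiX 2 =1 PX ((zq 1)%:P * 'X + (zq (-378))%:P * 'X^2 + (zq 8613)%:P * 'X^3
                + (zq (-54675))%:P * 'X^4 + (zq 138510)%:P * 'X^5
                + (zq (-150903))%:P * 'X^6 + (zq 59049)%:P * 'X^7) /\
  UxiX 3 =1 PX ((zq 147)%:P * 'X^2 + (zq (-14553))%:P * 'X^3 + (zq 312255)%:P * 'X^4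
                + (zq (-2617839))%:P * 'X^5 + (zq 10764414)%:P * 'X^6
                + (zq (-23914845))%:P * 'X^7 + (zq 29288304)%:P * 'X^8
                + (zq (-18600435))%:P * 'X^9 + (zq 4782969)%:P * 'X^10).
Proof.
have zq0 : zq 0 = 0 by [].
(* [zq] is generalised before [ring], which would otherwise unfold it to unary numerals. *)
split; [|split; [|split]].
(* Each list holds the coefficients from the constant term upward, 3k+2 entries in all; [vm_compute]
   checks the polynomial identity in c. *)
- apply: (@UxiX_Zpoly 0 [:: 0; 9])%BZ; [by [] | by vm_compute | idtac].
  by move: zq zq0 => f f0; rewrite /= f0; ring.
- apply: (@UxiX_Zpoly 1 [:: 0; -9; 252; -891; 729])%BZ; [by [] | by vm_compute | idtac].
  by move: zq zq0 => f f0; rewrite /= f0; ring.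
- apply: (@UxiX_Zpoly 2 [:: 0; 1; -378; 8613; -54675; 138510; -150903; 59049])%BZ;
    [by [] | by vm_compute | idtac].
  by move: zq zq0 => f f0; rewrite /= f0; ring.
- apply: (@UxiX_Zpoly 3 [:: 0; 0; 147; -14553; 312255; -2617839; 10764414; -23914845;
    29288304; -18600435; 4782969])%BZ; [by [] | by vm_compute | idtac].
  by move: zq zq0 => f f0; rewrite /= f0; ring.
Qed.
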